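(* Let $m\in\mathbb N_0$ and let $\nu_n=\tilde\nu_n\otimes\lambda$ ($0\le n\le m$), where each $\tilde\nu_n$ is a positive regular Borel measure on $[0,\infty)$ satisfying the $\Delta_2$-condition and $\lambda$ is Lebesgue measure on $i\mathbb R$. If $\mu$ is a (positive Borel) Carleson measure for the space $A^2(\mathbb C_+,(\nu_n)_{n=0}^m)$, then there exists a constant $C(\mu)>0$ such that for all $a\in\mathbb C_+$ $$\mu(Q(a))\le C(\mu)\sum_{n=0}^m\frac{\nu_n\left(\overline{Q(a)}\right)}{\operatorname{Re}(a)^{2n}},$$ where $\overline{Q(a)}$ denotes the closure of $Q(a)$ in $\mathbb C$.
   Context: $\mathbb C_+=\{z\in\mathbb C:\operatorname{Re}z>0\}$. A nonzero, locally finite positive regular Borel measure $\tilde\nu$ on $[0,\infty)$ satisfies the $\Delta_2$-condition if $\sup_{r>0}\tilde\nu[0,2r)/\tilde\nu[0,r)<\infty$. For $\nu=\tilde\nu\otimes\lambda$, a measure on $\overline{\mathbb C_+}=[0,\infty)\times i\mathbb R$, and $F$ analytic on $\mathbb C_+$, put $\|F\|_{A^2_\nu}^2=\sup_{\varepsilon>0}\int_{\overline{\mathbb C_+}}|F(z+\varepsilon)|^2\,d\nu(z)$. Then $A^2(\mathbb C_+,(\nu_n)_{n=0}^m)$ is the space of analytic $F:\mathbb C_+\to\mathbb C$ with $\|F\|^2:=\sum_{n=0}^m\|F^{(n)}\|_{A^2_{\nu_n}}^2<\infty$. A positive Borel measure $\mu$ on $\mathbb C_+$ is a Carleson measure for it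 if there is a constant $C>0$ with $\int_{\mathbb C_+}|F|^2\,d\mu\le C\|F\|^2$ for all $F$ in the space. For $a\in\mathbb C_+$ the Carleson square centred at $a$ is $$Q(a)=\{x+iy:\ 0<x\le 2\operatorname{Re}(a),\ |y-\operatorname{Im}(a)|\le\operatorname{Re}(a)\}.$$ *)

(* Defs.v *)
From HB Require Import structures.
From mathcomp Require Import all_boot all_order all_algebra.
From mathcomp Require Import complex.
From mathcomp Require Import all_classical all_reals all_analysis.

Set Implicit Arguments.
Unset Strict Implicit.
Unset Printing Implicit Defensive.

Import Order.TTheory GRing.Theory Num.Theory.
Import numFieldNormedType.Exports.

Local Open Scope classical_set_scope.
Local Open Scope ring_scope.
Local Open Scope complex_scope.

(* Borel measures on the complex plane are measures on the product R * R, whose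
   sigma-algebra is the product of the Borel ones, i.e. the Borel sigma-algebra
   of the plane; [cplx] transports subsets of R[i] and functions on R[i] to
   coordinates. *)

Notation plane R := (measurableTypeR R * measurableTypeR R)%type.

Definition cplx (R : realType) (p : plane R) : R[i] := p.1 +i* p.2.

(* The norm of R[i] takes its values in R[i]; this is the modulus in R. *)
Definition cabs (R : realType) (z : R[i]) : R := complex.Re `|z|.

Definition Cplus (R : realType) : set R[i] := [set z | 0 < complex.Re z].

Definition Cplus_bar (R : realType) : set R[i] := [set z | 0 <= complex.Re z].

(* Analytic = complex differentiable at every point of the open half-plane;
   the values of F outside of Cplus are irrelevant. *)
Definition analytic_on_Cplus (R : realType) (F : R[i] -> R[i]) : Prop :=
  forall z, Cplus z -> derivable (F : R[i]^o -> R[i]^o) z 1.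

(* Iterated complex derivative: R[i]^o is R[i] as a normed space over itself. *)
Definition cderiv (R : realType) (n : nat) (F : R[i] -> R[i]) : R[i] -> R[i] :=
  derive1n n (F : R[i]^o -> R[i]^o).

Section MeasuresOnHalfLine.
Local Open Scope ereal_scope.
Context {R : realType}.
Implicit Type nu : {measure set (measurableTypeR R) -> \bar R}.

Definition locally_finite_measure nu : Prop :=
  forall x : R, exists2 U : set R, open_nbhs x U & nu U < +oo.

Definition regular_measure nu : Prop :=
  forall A : set (measurableTypeR R), measurable A ->
    nu A = ereal_inf [set nu U | U in [set U : set R | open U /\ A `<=` U]] /\
    nu A = ereal_sup [set nu K | K in [set K : set R | compact K /\ K `<=` A]].

(* In \bar R, t / 0 = +oo for t > 0 and 0 / 0 = 0. The value given to 0 / 0 is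
   harmless: if nu is nonzero and vanishes on some `[0, r[, then for the largest
   such r the quotient is +oo. *)
Definition Delta2 nu : Prop :=
  ereal_sup [set nu `[0%R, (2 * r)%R[%classic / nu `[0%R, r[%classic
            | r in [set r : R | (0 < r)%R]] < +oo.

(* Measures on [0, +oo[ are measures on R that do not charge ]-oo, 0[. *)
Definition Delta2_measure nu : Prop :=
  [/\ nu `]-oo, 0%R[%classic = 0, nu setT != 0, locally_finite_measure nu,
      regular_measure nu & Delta2 nu].

End MeasuresOnHalfLine.

Section Spaces.
Local Open Scope ereal_scope.
Context {R : realType}.

Definition strip_measure (nu : {measure set (measurableTypeR R) -> \bar R}) :
    {measure set (plane R) -> \bar R} :=
  nu \x (@lebesgue_measure R).

Definition A2nu_normsq (nu : {measure set (measurableTypeR R) -> \bar R})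
    (F : R[i] -> R[i]) : \bar R :=
  ereal_sup [set \int[strip_measure nu]_(p in @cplx R @^-1` @Cplus_bar R)
                    (cabs (F (cplx p + e%:C)%R) ^+ 2)%:E
            | e in [set e : R | (0 < e)%R]].

Variable m : nat.
Variable nu : 'I_m.+1 -> {measure set (measurableTypeR R) -> \bar R}.

Definition A2_normsq (F : R[i] -> R[i]) : \bar R :=
  \sum_(n < m.+1) A2nu_normsq (nu n) (cderiv n F).

Definition A2 : set (R[i] -> R[i]) :=
  [set F | analytic_on_Cplus F /\ A2_normsq F < +oo].

(* A measure on Cplus is a measure on the plane of which only the restriction
   to Cplus is used. *)
Definition Carleson_measure (mu : {measure set (plane R) -> \bar R}) : Prop :=
  exists2 C : R, (0 < C)%R &
    forall F, A2 F ->
      \int[mu]_(p in @cplx R @^-1` @Cplus R) (cabs (F (cplx p)) ^+ 2)%:E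
        <= C%:E * A2_normsq F.

End Spaces.

Definition Carleson_square (R : realType) (a : R[i]) : set R[i] :=
  [set z | 0 < complex.Re z <= 2 * complex.Re a /\
           `|complex.Im z - complex.Im a| <= complex.Re a].

Definition C_closure (R : realType) (A : set R[i]) : set R[i] :=
  closure (A : set R[i]^o).

(* Main.v *)
Require Import Defs.
From HB Require Import structures.
From mathcomp Require Import all_boot all_order all_algebra.
From mathcomp Require Import complex.
From mathcomp Require Import all_classical all_reals all_analysis.
From mathcomp Require Import measurable_realfun ring lra.

Import Order.TTheory GRing.Theory Num.Theory.
Import numFieldNormedType.Exports.

Local Open Scope classical_set_scope.
Local Open Scope ring_scope.

(** Testing the Carleson inequality on a single family of functions suffices.
    For a = x + ib in the half-plane put F(z) = (z + conj a)^-k.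

    On the Carleson square Q(a) one has |z + conj a|^2 <= 10 x^2, so that
    |F|^2 >= (10 x^2)^-k there, and therefore
    (10 x^2)^-k mu(Q(a)) <= C ||F||^2, with the norm of the space on the right
    ([test_fun_integral_ge]).

    The norm of F is controlled by the measures of Q(a). The n-th derivative
    of F is a constant times (z + conj a)^-(k + n) ([cderiv_test_fun]). The
    boxes B_j = [0, 2^j x[ * [b - 2^j x, b + 2^j x] exhaust the half-plane, and
    |z + conj a| >= 2^j x outside B_j, whence the pointwise bound
    |z + conj a|^(-2p) <= \sum_j (2^j x)^(-2p) 1_(B_(j+1))
    ([invX_le_dyadic_series]). By the Delta_2-condition the measure of B_(j+1)
    is at most 2 (2 D)^j times that of the closure of Q(a)
    ([strip_measure_dyadic_box]). Hence, as soon as 4 D <= 4^p, integrating the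
    series term by term leaves a geometric series of ratio at most 1/2
    ([integral_cabs_sqr_invX_le]). One k large enough for the finitely many
    doubling constants D gives
    ||F||^2 <= B x^(-2k) \sum_n nu_n(closure of Q(a)) / x^(2n)
    with B independent of a ([A2_normsq_test_fun]); multiplying by (10 x^2)^k
    cancels the powers of x that depend on k.

    If the sum on the right is infinite there is nothing to prove; if it is
    finite, this same bound shows that F belongs to the space. *)

(** * Derivatives of inverse powers *)

Lemma is_derive_invXn (K : numFieldType) (w c z : K) (k : nat) : z + w != 0 ->
  is_derive (z : K^o) (1 : K^o) (fun y : K^o => c * (y + w) ^- k : K^o)
    (c * - k%:R * (z + w) ^- k.+1).
Proof.
move=> zw0.
have dX : is_derive (z : K^o) (1 : K^o)
    ((fun y : K^o => y + w : K^o) ^+ k) ((k%:R * (z + w) ^+ k.-1) *: (1 : K^o)).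
  apply: is_deriveX; apply: is_derive_eq; exact: addr0.
have Xn0 : (z + w) ^+ k != 0 by rewrite expf_neq0.
have fE : (fun y : K^o => c * (y + w) ^- k : K^o) =
   c \*: (fun y : K^o => (((fun y : K^o => y + w : K^o) ^+ k) y)^-1).
  by apply/funext => y /=; rewrite exprfctE.
have dV : is_derive (z : K^o) (1 : K^o)
    (fun y : K^o => (((fun y : K^o => y + w : K^o) ^+ k) y)^-1)
    (- k%:R * (z + w) ^- k.+1).
  have Xn0' : ((fun y : K^o => y + w : K^o) ^+ k) z != 0 by rewrite exprfctE.
  apply: DeriveDef; first exact: derivableV (@ex_derive _ _ _ _ _ _ _ dX).
  rewrite (deriveV Xn0' (@ex_derive _ _ _ _ _ _ _ dX)).
  rewrite (@derive_val _ _ _ _ _ _ _ dX).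
  rewrite exprfctE /= scaler1 /GRing.scale /=.
  case: k {fE dX Xn0'} Xn0 => [|k] Xn0; first by rewrite !(mul0r, mulr0, oppr0).
  rewrite /= !exprS; field.
  by rewrite expf_neq0.
by rewrite fE -mulrA; apply: is_deriveZ.
Qed.

(** The formula at one point does not suffice for the induction: it is
    differentiated again, so it is used on the whole neighbourhood of z where
    the pole - w is avoided. *)
Lemma derive1n_invXn (K : numFieldType) (w : K) (k n : nat) (z : K) :
  z + w != 0 ->
  derive1n n (fun y : K^o => (y + w) ^- k : K^o) z =
    (\prod_(i < n) - (k + i)%:R) * (z + w) ^- (k + n).
Proof.
elim: n z => [|n IH] z zw0; first by rewrite big_ord0 mul1r addn0.
rewrite derive1nS derive1E.
have nearE : \forall y \near (z : K^o),
    derive1n n (fun y : K^o => (y + w) ^- k : K^o) y =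
    (\prod_(i < n) - (k + i)%:R) * (y + w) ^- (k + n).
  have : \forall y \near (z : K^o), y + w != 0.
    have F := nbhs_filter (z : K^o).
    have yw := @cvgD K K^o K^o _ F _ _ _ _ cvg_id (@cvg_cst K^o w _ _ F).
    exact: (@cvgr_neq0 _ K^o _ _ F _ _ yw zw0).
  by apply: filterS => y; exact: IH.
rewrite (near_eq_derive _ nearE).
rewrite (@derive_val _ _ _ _ _ _ _ (@is_derive_invXn _ _ _ _ _ zw0)).
by rewrite big_ord_recr /= addnS.
Qed.

(** * Doubling measures on the half-line *)

Section HalfLine.
Local Open Scope ereal_scope.
Context {R : realType}.
Implicit Type nu : {measure set (measurableTypeR R) -> \bar R}.

Definition doubling nu (D : R) : Prop := forall r : R, (0 < r)%R ->
  nu `[0%R, (2 * r)%R[%classic <= D%:E * nu `[0%R, r[%classic.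

(** Passing from the quotient to the product form is harmless in the degenerate
    cases: a denominator +oo bounds everything, and a denominator 0 with a
    bounded quotient forces the numerator to vanish because t / 0 = +oo for
    t > 0. *)
Lemma Delta2_doubling nu : Delta2 nu -> exists2 D : R, (1 <= D)%R & doubling nu D.
Proof.
rewrite /Delta2; set s := ereal_sup _ => soo.
have [D D1 sD] : exists2 D : R, (1 <= D)%R & s <= D%:E.
  case: s soo => [t| |] //= _; last by exists 1%R => //; rewrite leNye.
  by exists (Num.max 1 t)%R; rewrite ?le_max ?lexx// lee_fin le_max lexx orbT.
exists D => // r r0.
have D0 : (0 < D)%R by exact: (lt_le_trans ltr01).
have h : nu `[0%R, (2 * r)%R[%classic / nu `[0%R, r[%classic <= D%:E.
  by apply: le_trans sD; apply: ereal_sup_ubound; exists r.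
have [->|nuoo] := eqVneq (nu `[0%R, r[%classic) +oo.
  by rewrite gt0_muley ?lte_fin// leey.
have [nu0|nu0] := eqVneq (nu `[0%R, r[%classic) 0.
  move: h; rewrite nu0 inve0 mule0.
  have := measure_ge0 nu `[0%R, (2 * r)%R[%classic.
  by rewrite le_eqVlt => /predU1P[<-//|nu2]; rewrite gt0_muley.
have nufin : nu `[0%R, r[%classic \is a fin_num.
  by rewrite ge0_fin_numE// ltey.
have fnu0 : (0 < fine (nu `[0%R, r[%classic))%R.
  by rewrite fine_gt0// lt0e nu0 measure_ge0/= ltey.
rewrite -[X in _ * X](fineK nufin) -lee_pdivrMr//.
by move: h; rewrite -[X in _ / X](fineK nufin) inver gt_eqF.
Qed.

Lemma doubling_iter nu (D : R) : (0 <= D)%R -> doubling nu D ->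
  forall (j : nat) (r : R), (0 < r)%R ->
    nu `[0%R, (2 ^+ j * r)%R[%classic <= (D ^+ j)%:E * nu `[0%R, r[%classic.
Proof.
move=> D0 hD; elim=> [|j IH] r r0; first by rewrite !expr0 mul1r mul1e.
rewrite exprS -mulrA; apply: (le_trans (hD _ _)).
  by rewrite mulr_gt0 ?exprn_gt0.
by rewrite exprS EFinM -muleA lee_wpmul2l ?IH.
Qed.
End HalfLine.

(** * Modulus, closure and Carleson squares in coordinates *)

Section Plane.
Local Open Scope complex_scope.
Context {R : realType}.
Implicit Types (a z w : R[i]).

Lemma cabs_sqr z : cabs z ^+ 2 = complex.Re z ^+ 2 + complex.Im z ^+ 2.
Proof. by rewrite /cabs normc_def /= sqr_sqrtr// addr_ge0// sqr_ge0. Qed.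

Lemma cabsM z w : cabs (z * w) = cabs z * cabs w.
Proof. by rewrite /cabs normrM !normc_def /= !(mulr0,mul0r,subr0). Qed.

Lemma cabsV z : cabs z^-1 = (cabs z)^-1.
Proof.
have [->|z0] := eqVneq z 0; first by rewrite invr0 /cabs normr0 /= invr0.
have cz0 : cabs z != 0.
  apply: contra_neq z0 => cz0; apply/eqP; rewrite -normr_eq0 normc_def.
  by move: cz0; rewrite /cabs normc_def /= => ->.
by apply: (mulfI cz0); rewrite -cabsM !divff// /cabs normr1.
Qed.

Lemma cabsX z n : cabs (z ^+ n) = cabs z ^+ n.
Proof.
elim: n => [|n IH]; last by rewrite !exprS cabsM IH.
by rewrite !expr0 /cabs normr1.
Qed.

(** The topology of R[i] is given by balls whose radius is an element of R[i];
    only the radii in R matter. *)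
Lemma cabs_lt_ball z w (r : R) :
  ball (z : R[i]^o) (r%:C : R[i]) (w : R[i]^o) = (cabs (z - w) < r) :> Prop.
Proof. by rewrite /ball/= /cabs normc_def ltcR. Qed.

Lemma Re_le_cabs z : `|complex.Re z| <= cabs z.
Proof. by have := normc_ge_Re z; rewrite /cabs normc_def lecR. Qed.

Lemma Im_le_cabs z : `|complex.Im z| <= cabs z.
Proof.
by rewrite -sqrtr_sqr /cabs normc_def/= ler_wsqrtr// lerDr sqr_ge0.
Qed.

Lemma C_closureP (A : set R[i]) z :
  C_closure A z <-> forall r : R, 0 < r -> exists2 w, A w & cabs (z - w) < r.
Proof.
split=> [Az r r0|h B].
  have /Az[w [Aw zw]] : nbhs (z : R[i]^o) (ball (z : R[i]^o) (r%:C : R[i])).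
    by apply: nbhsx_ballx; rewrite ltcR.
  by exists w => //; rewrite -cabs_lt_ball.
rewrite -nbhs_ballE => -[e/= e0 zeB].
have eE : e = (complex.Re e)%:C.
  by rewrite RRe_real// gtr0_real.
have [|w Aw zw] := h (complex.Re e); first by move: e0; rewrite eE ltcR.
by exists w; split => //; apply: zeB; rewrite eE cabs_lt_ball.
Qed.

Lemma cplx_Carleson_square a :
  @cplx R @^-1` Carleson_square a =
  `]0, (2 * complex.Re a)] `*`
  `[(complex.Im a - complex.Re a), (complex.Im a + complex.Re a)].
Proof.
apply/seteqP; split => -[u v] /=; rewrite /Carleson_square /= !in_itv/=.
  by rewrite ler_distl => -[].
by rewrite ler_distl.
Qed.

(** Taking the closure adds the segment of the imaginary axis that bounds the
    square. That segment matters, since the measures may charge it. *)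
Lemma cplx_closure_Carleson_square a : Cplus a ->
  @cplx R @^-1` C_closure (Carleson_square a) =
  `[0, (2 * complex.Re a)] `*`
  `[(complex.Im a - complex.Re a), (complex.Im a + complex.Re a)].
Proof.
case: a => x b; rewrite /Cplus /= => x0; apply/seteqP; split => -[u v] /=.
  move=> /C_closureP h.
  have {}h e : 0 < e ->
      [/\ - e <= u, u <= 2 * x + e, b - x <= v + e & v <= b + x + e].
    move=> /h[[u' v']] [] /= /andP[u'0 u'x] v'b zlt.
    have := le_lt_trans (Re_le_cabs _) zlt.
    have := le_lt_trans (Im_le_cabs _) zlt.
    rewrite /= !ltr_distl => /andP[? ?] /andP[? ?].
    by move: v'b; rewrite ler_distl => /andP[? ?]; split; lra.
  have u0 : 0 <= u.
    by apply/ler_addgt0Pr => e /h[]; lra.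
  have ux : u <= 2 * x by apply/ler_addgt0Pr => e /h[].
  have bv : b - x <= v by apply/ler_addgt0Pr => e /h[].
  have vb : v <= b + x by apply/ler_addgt0Pr => e /h[]; lra.
  by rewrite !in_itv /= u0 ux bv vb.
rewrite !in_itv /= => -[/andP[u0 ux] /andP[bv vb]].
apply/C_closureP => e e0.
(* The segment on the imaginary axis is approached horizontally, by points of
   abscissa min (e / 2, 2 x). *)
have [ue|eu] := ltP u (Num.min (e / 2) (2 * x)); last first.
  exists (u +i* v).
    split=> /=; last by rewrite ler_distl bv vb.
    by rewrite ux (lt_le_trans _ eu)// lt_min divr_gt0 ?mulr_gt0.
  by rewrite subrr /cabs normr0.
exists (Num.min (e / 2) (2 * x) +i* v).
  split=> /=; last by rewrite ler_distl bv vb.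
  by rewrite lt_min divr_gt0 ?mulr_gt0//= ge_min lexx orbT.
set d := Num.min _ _ in ue *.
have dE : d <= e / 2 by rewrite ge_min lexx.
rewrite /cabs normc_def /= subrr expr0n addr0 sqrtr_sqr ltr_norml; lra.
Qed.
End Plane.

(** * Dyadic boxes *)

Section DyadicBoxes.
Context {R : realType}.
Variables (x b : R).
Hypothesis x0 : 0 < x.

Definition dyadic_box (j : nat) : set (plane R) :=
  `[0, 2 ^+ j * x[ `*` `[b - 2 ^+ j * x, b + 2 ^+ j * x].

Lemma measurable_dyadic_box j : measurable (dyadic_box j).
Proof. by apply: measurableX; exact: measurable_itv. Qed.

Lemma notin_dyadic_box j (u v : R) : 0 <= u -> ~ dyadic_box j (u, v) ->
  4 ^+ j * x ^+ 2 <= (u + x) ^+ 2 + (v - b) ^+ 2.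
Proof.
move=> u0; rewrite /dyadic_box /= !in_itv /= u0 /= => /not_andP uv.
have -> : 4 ^+ j * x ^+ 2 = (2 ^+ j * x) ^+ 2.
  by rewrite exprMn exprAC; congr (_ ^+ _ * _); ring.
have t0 : 0 < 2 ^+ j * x by rewrite mulr_gt0 ?exprn_gt0.
move: t0 uv; move: (2 ^+ j * x) => t t0 uv.
have sqr_le (y : R) : t <= y -> t ^+ 2 <= y ^+ 2.
  by move=> ty; rewrite lerXn2r ?nnegrE; lra.
have := sqr_ge0 (u + x); have := sqr_ge0 (v - b).
move=> v2 u2; case: uv => /negP.
  rewrite -leNgt => tu.
  have tux : t <= u + x by apply: ler_wpDr tu; exact: ltW.
  by have := sqr_le _ tux; lra.
rewrite negb_and -!ltNge => /orP[vt|vt].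
  have tbv : t <= b - v by lra.
  by have := sqr_le _ tbv; rewrite -[(b - v) ^+ 2]sqrrN opprB; lra.
have tvb : t <= v - b by lra.
by have := sqr_le _ tvb; lra.
Qed.

Lemma dyadic_box_exhaust (u v : R) : 0 <= u -> exists j, dyadic_box j (u, v).
Proof.
move=> u0; pose t := (u + `|v - b|) / x.
have t0 : 0 <= t by rewrite divr_ge0 ?addr_ge0 ?(ltW x0).
exists (Num.bound t).
have : u + `|v - b| < 2 ^+ Num.bound t * x.
  rewrite -ltr_pdivrMr//; apply: (lt_trans (archi_boundP t0)).
  by rewrite -natrX ltr_nat ltn_expl.
have := ler_norm (v - b); have := ler_norm (b - v); rewrite distrC => h1 h2 h3.
by rewrite /dyadic_box /= !in_itv /= u0 /=; split; [|apply/andP; split]; lra.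
Qed.

(** A point of box 0 satisfies the bound with j = 0 because (u + x)^2 >= x^2.
    For any other point j.+1 is the first index of a box that contains it, and
    the bound expresses that box j is missed. *)
Lemma dyadic_shell (u v : R) : 0 <= u -> exists j,
  dyadic_box j.+1 (u, v) /\ 4 ^+ j * x ^+ 2 <= (u + x) ^+ 2 + (v - b) ^+ 2.
Proof.
move=> u0; have [n nP] := dyadic_box_exhaust u v u0.
have : exists j, `[< dyadic_box j (u, v) >] by exists n; exact/asboolP.
move/ex_minnP => [[|j] /asboolP jP jmin].
  exists 0; split; last first.
    have ux := mulr_ge0 u0 (ltW x0); have u2 := sqr_ge0 u.
    by rewrite expr0 mul1r; have := sqr_ge0 (v - b); lra.
  move: jP; rewrite /dyadic_box /= !in_itv /= expr0 expr1.
  move=> -[/andP[? ?] /andP[? ?]].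
  split; first by apply/andP; split; lra.
  by apply/andP; split; lra.
exists j; split => //; apply: notin_dyadic_box => // /asboolP/jmin.
by rewrite ltnn.
Qed.

Local Open Scope ereal_scope.

(** The single term of the series that belongs to the dyadic shell of (u, v)
    already majorizes. *)
Lemma invX_le_dyadic_series (p : nat) (u v w : R) : (0 <= u)%R ->
  ((u + x) ^+ 2 + (v - b) ^+ 2 <= w)%R ->
  (w ^- p)%:E <=
  \sum_(j <oo) ((4 ^+ j * x ^+ 2) ^- p)%:E * (\1_(dyadic_box j.+1) (u, v))%:E.
Proof.
move=> u0 uvw; have [j [uvj jw]] := dyadic_shell u v u0.
have r0 k : (0 < 4 ^+ k * x ^+ 2)%R by rewrite mulr_gt0 ?exprn_gt0.
have term0 k :
    0 <= ((4 ^+ k * x ^+ 2) ^- p)%:E * (\1_(dyadic_box k.+1) (u, v))%:E.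
  by rewrite -EFinM lee_fin mulr_ge0// invr_ge0 exprn_ge0// ltW.
rewrite (nneseriesD1 (n := j))//.
rewrite [in X in _ <= X + _]indicE mem_set//= mule1 -[leLHS]adde0 leeD//.
  have rw : (4 ^+ j * x ^+ 2 <= w)%R := le_trans jw uvw.
  have w0 : (0 < w)%R := lt_le_trans (r0 j) rw.
  by rewrite lee_fin lef_pV2 ?posrE ?exprn_gt0// lerXn2r// nnegrE ltW.
exact: nneseries_ge0.
Qed.

Lemma strip_measureX (nu : {measure set (measurableTypeR R) -> \bar R})
    (A B : set (measurableTypeR R)) : measurable A -> measurable B ->
  strip_measure nu (A `*` B) = nu A * lebesgue_measure B.
Proof. move=> mA mB; exact: (product_measure1E nu lebesgue_measure mA mB). Qed.

(** Each step from one box to the next costs a factor D in the first coordinate,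
    by doubling, and exactly 2 in the second one. *)
Lemma strip_measure_dyadic_box
    (nu : {measure set (measurableTypeR R) -> \bar R}) (D : R) : (0 <= D)%R ->
  doubling nu D ->
  forall j, strip_measure nu (dyadic_box j.+1) <=
    (2 * (2 * D) ^+ j)%:E *
      strip_measure nu (`[0%R, (2 * x)%R] `*` `[(b - x)%R, (b + x)%R]).
Proof.
move=> D0 hD j; rewrite /dyadic_box !strip_measureX; try exact: measurable_itv.
have t0 k : (0 < 2 ^+ k * x)%R by rewrite mulr_gt0 ?exprn_gt0.
have len r : (0 < r)%R ->
    lebesgue_measure `[(b - r)%R, (b + r)%R] = (2 * r)%:E.
  move=> r0; rewrite lebesgue_measure_itv/= lte_fin ifT; last by lra.
  by rewrite -EFinD; congr EFin; lra.
rewrite !len//.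
have -> : (2 * (2 * D) ^+ j)%:E * (nu `[0%R, (2 * x)%R]%classic * (2 * x)%:E) =
   (D ^+ j)%:E * nu `[0%R, (2 * x)%R]%classic * (2 * (2 ^+ j.+1 * x))%:E.
  rewrite (muleC (nu _)) muleA -EFinM [RHS]muleAC -EFinM; congr (_%:E * _).
  by rewrite exprMn exprS; ring.
apply: lee_wpmul2r; first by rewrite lee_fin mulr_ge0// ltW// mulr_gt0.
rewrite exprSr -mulrA.
apply: (le_trans (doubling_iter nu D D0 hD j _ _)); first by rewrite mulr_gt0.
apply: lee_wpmul2l; first by rewrite lee_fin exprn_ge0.
apply: le_measure; rewrite ?inE; try exact: measurable_itv.
by move=> r /=; rewrite !in_itv/= => /andP[-> /ltW].
Qed.

End DyadicBoxes.

(** * Integrals of inverse powers over the half-plane *)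

(** This is where the size of the exponent enters: 4 D <= 4^p makes
    2 D / 4^p at most 1/2. The right-hand side has the form of the terms of a
    geometric series with sum 4 c x^(-2p). *)
Lemma dyadic_coef_le (R : realType) (c x D : R) (p j : nat) :
  0 < x -> 0 <= D -> 4 * D <= 4 ^+ p -> 0 <= c ->
  c * (4 ^+ j * x ^+ 2) ^- p * (2 * (2 * D) ^+ j) <=
  4 * c * (x ^+ 2) ^- p / (2 ^ (j + 1))%:R.
Proof.
move=> x0 D0 Dp c0.
have P0 : 0 < (4 ^+ p) ^+ j :> R by rewrite !exprn_gt0.
have DP : (2 * D) ^+ j <= (4 ^+ p) ^+ j / 2 ^+ j.
  by rewrite -expr_div_n lerXn2r ?nnegrE ?divr_ge0 ?exprn_ge0 ?mulr_ge0//; lra.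
have -> : c * (4 ^+ j * x ^+ 2) ^- p * (2 * (2 * D) ^+ j) =
    2 * c * (x ^+ 2) ^- p * (((4 ^+ p) ^+ j)^-1 * (2 * D) ^+ j).
  rewrite [(_ * x ^+ 2) ^+ p]exprMn invfM [(4 ^+ j) ^+ p]exprAC.
  by move: ((2 * D) ^+ j) (_^-1) (_^-1) => t u v; ring.
have -> : 4 * c * (x ^+ 2) ^- p / (2 ^ (j + 1))%:R =
    2 * c * (x ^+ 2) ^- p * (2 ^+ j)^-1.
  rewrite addn1 natrX [_ ^+ j.+1]exprS invfM.
  by move: ((x ^+ 2) ^- p) => t; field.
apply: ler_wpM2l; last by rewrite ler_pdivrMl// mulrC.
by rewrite !mulr_ge0// invr_ge0 !exprn_ge0// ltW.
Qed.

Section Integrals.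
Context {R : realType}.
Local Open Scope ereal_scope.

Lemma measurable_Cplus_bar : measurable (@cplx R @^-1` @Cplus_bar R).
Proof.
have -> : @cplx R @^-1` @Cplus_bar R = `[0%R, +oo[%classic `*` setT.
  by apply/seteqP; split => -[u v]; rewrite /= in_itv/= andbT => // -[].
by apply: measurableX => //; exact: measurable_itv.
Qed.

Lemma measurable_Cplus : measurable (@cplx R @^-1` @Cplus R).
Proof.
have -> : @cplx R @^-1` @Cplus R = `]0%R, +oo[%classic `*` setT.
  by apply/seteqP; split => -[u v]; rewrite /= in_itv/= andbT => // -[].
by apply: measurableX => //; exact: measurable_itv.
Qed.

Lemma cabs_sqr_invX (c w : R[i]) (k : nat) (p : plane R) :
  (cabs (c * (cplx p + w) ^- k) ^+ 2 =
   cabs c ^+ 2 * ((p.1 + complex.Re w) ^+ 2 + (p.2 + complex.Im w) ^+ 2) ^- k)%R.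
Proof.
rewrite cabsM cabsV cabsX exprMn exprVn -exprM mulnC exprM.
by rewrite (cabs_sqr (cplx p + w)%R); case: w.
Qed.

Lemma measurable_cabs_sqr_invX (c w : R[i]) (k : nat) (D : set (plane R)) :
  measurable_fun D
    (fun p : plane R =>
       (cabs (c * (cplx p + w) ^- k) ^+ 2)%R : measurableTypeR R).
Proof.
apply: measurable_funTS.
(* Real powers are measurable everywhere; the inverse is the power - 1. *)
under eq_fun do rewrite cabs_sqr_invX -powR_inv1 ?exprn_ge0 ?addr_ge0 ?sqr_ge0//.
apply: measurable_funM => //.
apply: (measurableT_comp (@measurable_powR R (-1)%R)) => //.
by apply: measurable_funX; apply: measurable_funD; apply: measurable_funX;
  exact: measurable_funD.
Qed.

(** The inequality x <= Re w, rather than an equality, makes the bound uniform in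
    the translations z + e, e > 0, that define the norm. *)
Lemma integral_cabs_sqr_invX_le
    (nu : {measure set (measurableTypeR R) -> \bar R})
    (D x b : R) (c w : R[i]) (p : nat) :
  (0 < x)%R -> (x <= complex.Re w)%R -> complex.Im w = (- b)%R ->
  (0 <= D)%R -> doubling nu D -> (4 * D <= 4 ^+ p)%R ->
  \int[strip_measure nu]_(q in @cplx R @^-1` @Cplus_bar R)
      (cabs (c * (cplx q + w) ^- p) ^+ 2)%:E <=
    (4 * cabs c ^+ 2 * (x ^+ 2) ^- p)%:E *
    strip_measure nu (`[0%R, (2 * x)%R] `*` `[(b - x)%R, (b + x)%R]).
Proof.
move=> x0 xw wb D0 hD Dp.
have mC := measurable_Cplus_bar.
set S := strip_measure nu _.
have S0 : 0 <= S by exact: measure_ge0.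
have C0 : (0 <= cabs c ^+ 2)%R by exact: sqr_ge0.
have inv0 j : (0 <= (4 ^+ j * x ^+ 2) ^- p)%R.
  by rewrite invr_ge0 exprn_ge0// mulr_ge0 ?sqr_ge0// exprn_ge0.
pose cj j : R := (cabs c ^+ 2 * (4 ^+ j * x ^+ 2) ^- p)%R.
have cj0 j : (0 <= cj j)%R by rewrite mulr_ge0.
pose g j (q : plane R) := (cj j)%:E * (\1_(dyadic_box x b j.+1) q)%:E.
have g0 j q : 0 <= g j q by rewrite /g -EFinM lee_fin mulr_ge0.
have mg A j : measurable_fun A (g j).
  apply: measurable_funeM; apply/measurable_EFinP; apply: measurable_indic.
  exact: measurable_dyadic_box.
have fg q : (0 <= q.1)%R ->
    (cabs (c * (cplx q + w) ^- p) ^+ 2)%:E <= \sum_(j <oo) g j q.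
  case: q => u v /= u0; rewrite cabs_sqr_invX /= wb EFinM.
  have uvw : ((u + x) ^+ 2 + (v - b) ^+ 2 <=
      (u + complex.Re w) ^+ 2 + (v - b) ^+ 2)%R.
    by rewrite lerD2r lerXn2r ?nnegrE//; lra.
  have := invX_le_dyadic_series x b x0 p u v _ u0 uvw.
  move=> /(lee_wpmul2l _) - /(_ (cabs c ^+ 2)%:E); rewrite lee_fin => /(_ C0).
  move=> /le_trans; apply; rewrite -nneseriesZl//; last first.
    by move=> j _; rewrite -EFinM lee_fin mulr_ge0.
  apply: lee_nneseries => [j _ _|j _]; last first.
    by rewrite /g (EFinM (cabs c ^+ 2)) -muleA.
  by rewrite -!EFinM lee_fin mulr_ge0// mulr_ge0.
apply: (@le_trans _ _ (\int[strip_measure nu]_(q in @cplx R @^-1` @Cplus_bar R)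
    \sum_(j <oo) g j q)).
  apply: ge0_le_integral => //.
  - by move=> q _; rewrite lee_fin sqr_ge0.
  - by apply/measurable_EFinP; exact: measurable_cabs_sqr_invX.
  - by apply: ge0_emeasurable_sum.
rewrite integral_nneseries//.
have bound j : \int[strip_measure nu]_(q in @cplx R @^-1` @Cplus_bar R) g j q <=
    ((4 * cabs c ^+ 2 * (x ^+ 2) ^- p) / (2 ^ (j + 1))%:R)%:E * S.
  have mB := measurable_dyadic_box x b j.+1.
  rewrite /g ge0_integralZl_EFin//; last first.
    by apply/measurable_EFinP; apply: measurable_indic.
  rewrite integral_indic//.
  apply: (@le_trans _ _ ((cj j)%:E * ((2 * (2 * D) ^+ j)%:E * S))).
    apply: lee_wpmul2l; first by rewrite lee_fin.
    apply: le_trans (strip_measure_dyadic_box x b x0 nu D D0 hD j).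
    by apply: le_measure; rewrite ?inE//; exact: measurableI.
  rewrite muleA -EFinM; apply: lee_wpmul2r => //; rewrite lee_fin.
  exact: (dyadic_coef_le R (cabs c ^+ 2) x D p j).
apply: (@le_trans _ _ (\sum_(j <oo)
    ((4 * cabs c ^+ 2 * (x ^+ 2) ^- p) / (2 ^ (j + 1))%:R)%:E * S)).
  by apply: lee_nneseries => [j _ _|j _ //]; exact: integral_ge0.
have r0 : (0 <= 4 * cabs c ^+ 2 * (x ^+ 2) ^- p)%R.
  by apply: mulr_ge0; [exact: mulr_ge0|rewrite invr_ge0 !exprn_ge0// ltW].
set r := (4 * cabs c ^+ 2 * _)%R in r0 *.
have rj0 j : 0 <= (r / (2 ^ (j + 1))%:R)%:E by rewrite lee_fin divr_ge0.
(* S may be infinite, so it is factored out of the partial sums, not of the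
   series. *)
apply: lime_le; first by apply: is_cvg_nneseries => j _ _; rewrite mule_ge0.
apply: nearW => N; rewrite -ge0_sume_distrl//; apply: lee_wpmul2r => //.
apply: le_trans (nneseries_lim_ge _ _) _; first by move=> j _ _; exact: rj0.
rewrite (cvg_lim _ (@cvg_geometric_eseries_half R r 0))//.
by rewrite expr0 divr1.
Qed.
End Integrals.

(** * The test functions *)

Section TestFunctions.
Local Open Scope complex_scope.
Context {R : realType}.
Implicit Types a z : R[i].

(** The pole - conj a is the reflection of a in the imaginary axis: it stays at
    distance Re a from the half-plane, on the scale of the square Q(a). *)
Definition test_fun (k : nat) a : R[i] -> R[i] := fun z => (z + conjc a) ^- k.

Lemma Cplus_bar_addJ_neq0 a z : Cplus a -> Cplus_bar z -> z + conjc a != 0.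
Proof.
case: a z => x b [u v]; rewrite /Cplus /Cplus_bar /= => x0 u0.
by rewrite eq_complex /= negb_and gt_eqF// ltr_wpDl.
Qed.

Lemma analytic_test_fun k a : Cplus a -> analytic_on_Cplus (test_fun k a).
Proof.
move=> a0 z z0.
have zb : Cplus_bar z by exact: ltW.
have -> : test_fun k a = fun y => 1 * (y + conjc a) ^- k.
  by apply/funext => y; rewrite mul1r.
exact: (@ex_derive _ _ _ _ _ _ _
  (is_derive_invXn R[i] (conjc a) 1 z k (Cplus_bar_addJ_neq0 a z a0 zb))).
Qed.

Lemma cderiv_test_fun k n a z : Cplus a -> Cplus_bar z ->
  cderiv n (test_fun k a) z =
    (\prod_(i < n) - (k + i)%:R) * (z + conjc a) ^- (k + n).
Proof.
by move=> a0 z0; rewrite /cderiv derive1n_invXn// Cplus_bar_addJ_neq0.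
Qed.

Local Open Scope ereal_scope.

Lemma A2nu_normsq_test_fun (nu : {measure set (measurableTypeR R) -> \bar R})
    (D : R) (k n : nat) a :
  Cplus a -> (0 <= D)%R -> (4 * D <= 4 ^+ (k + n))%R ->
  doubling nu D ->
  A2nu_normsq nu (cderiv n (test_fun k a)) <=
    (4 * cabs (\prod_(i < n) - (k + i)%:R : R[i]) ^+ 2 *
       (complex.Re a ^+ 2) ^- (k + n))%:E *
    strip_measure nu (@cplx R @^-1` C_closure (Carleson_square a)).
Proof.
move=> a0 D0 Dk hD; rewrite cplx_closure_Carleson_square//.
apply: ge_ereal_sup => _ [e /= e0 <-].
set c : R[i] := (\prod_(i < n) _)%R.
have FE p : Cplus_bar (cplx p) ->
    cderiv n (test_fun k a) (cplx p + e%:C)%R =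
    (c * (cplx p + (e%:C + conjc a)) ^- (k + n))%R.
  move=> p0; rewrite cderiv_test_fun ?addrA//.
  by move: p0; rewrite /Cplus_bar /= => p0; rewrite addr_ge0 ?(ltW e0).
rewrite (eq_integral
    (fun p => (cabs (c * (cplx p + (e%:C + conjc a)) ^- (k + n)) ^+ 2)%:E)).
  2: by move=> p; rewrite inE => p0; rewrite FE.
apply: (integral_cabs_sqr_invX_le nu D) => //.
- by case: a {a0 FE} => x b /=; rewrite lerDr ltW.
- by case: a {a0 FE} => x b /=; rewrite add0r.
Qed.

(** On the square Re (z + conj a) is at most 3 Re a and |Im (z + conj a)| at most
    Re a; this is the origin of 10 = 3^2 + 1^2. *)
Lemma test_fun_ge k a (p : plane R) : Cplus a -> Carleson_square a (cplx p) ->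
  ((10 * complex.Re a ^+ 2) ^- k <= cabs (test_fun k a (cplx p)) ^+ 2)%R.
Proof.
case: a p => x b [u v]; rewrite /Cplus /Carleson_square /= => x0.
rewrite ler_distl => -[/andP[u0 ux] /andP[bv vb]].
rewrite -[test_fun _ _ _]mul1r cabs_sqr_invX /= {1}/cabs normr1 expr1n mul1r.
have w0 : (0 < (u + x) ^+ 2 + (v - b) ^+ 2)%R.
  by rewrite ltr_pwDl ?sqr_ge0// exprn_gt0// addr_gt0.
rewrite lef_pV2 ?posrE ?exprn_gt0 ?mulr_gt0 ?exprn_gt0//.
rewrite lerXn2r ?nnegrE ?(ltW w0)//.
  by rewrite mulr_ge0 ?sqr_ge0.
have h1 : ((u + x) ^+ 2 <= (3 * x) ^+ 2)%R by rewrite lerXn2r ?nnegrE//; lra.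
have h2 : ((v - b) ^+ 2 <= x ^+ 2)%R.
  by rewrite -ler_sqrt ?sqr_ge0// !sqrtr_sqr (gtr0_norm x0) ler_norml; lra.
lra.
Qed.

(** The exponent k and the constant B depend on the doubling constants of the
    nu_n, but not on a. *)
Lemma A2_normsq_test_fun (m : nat)
    (nu : 'I_m.+1 -> {measure set (measurableTypeR R) -> \bar R}) :
  (forall n, Delta2 (nu n)) ->
  exists k : nat, exists2 B : R, (0 < B)%R & forall a : R[i], Cplus a ->
    A2_normsq nu (test_fun k a) <=
      (B * (complex.Re a ^+ 2) ^- k)%:E * \sum_(n < m.+1)
         strip_measure (nu n) (@cplx R @^-1` C_closure (Carleson_square a))
           / (complex.Re a ^+ (2 * n))%:E.
Proof.
move=> hnu.
have /choice[D hD] n : exists D : R, (1 <= D)%R /\ doubling (nu n) D.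
  by have [D D1 hD] := Delta2_doubling _ (hnu n); exists D.
have D0 n : (0 <= D n)%R by apply: le_trans (hD n).1.
have sum_ge (G : 'I_m.+1 -> R) n :
    (forall i, (0 <= G i)%R) -> (G n <= \sum_i G i)%R.
  by move=> G0; rewrite (bigD1 n)//= lerDl sumr_ge0.
(* 4^(k - 1) exceeds all D n; the factor 4 of kD accounts for the remaining
   unit. *)
pose k := (Num.bound (\sum_n D n)%R).+1.
have kD n j : (4 * D n <= 4 ^+ (k + j))%R.
  apply: (@le_trans _ _ (4 ^+ k)%R).
    2: by rewrite ler_weXn2l ?leq_addr// ler1n.
  rewrite /k exprS ler_pM2l//; apply: (le_trans (sum_ge D n D0)).
  apply: ltW; apply: (lt_trans (archi_boundP (sumr_ge0 _ (fun i _ => D0 i)))).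
  by rewrite -natrX ltr_nat ltn_expl.
pose c (n : 'I_m.+1) : R := (cabs (\prod_(i < n) - (k + i)%:R : R[i]) ^+ 2)%R.
have c0 n : (0 <= c n)%R by exact: sqr_ge0.
exists k; exists (4 * (\sum_n c n + 1))%R.
  by rewrite mulr_gt0// ltr_wpDl// sumr_ge0.
move=> a a0; rewrite ge0_sume_distrr; last first.
  move=> n _; rewrite inver gt_eqF ?exprn_gt0// mule_ge0 ?measure_ge0//.
  by rewrite lee_fin invr_ge0 exprn_ge0// ltW.
apply: lee_sum => n _.
apply: (le_trans (A2nu_normsq_test_fun (nu n) (D n) k n a a0
  (D0 n) (kD n n) (hD n).2)).
rewrite inver gt_eqF ?exprn_gt0// [X in _ <= _ * X]muleC muleA -EFinM.
apply: lee_wpmul2r; first exact: measure_ge0.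
rewrite lee_fin -/(c n).
have -> : ((complex.Re a ^+ 2) ^- (k + n) =
    (complex.Re a ^+ 2) ^- k * (complex.Re a ^+ (2 * n))^-1)%R.
  by rewrite exprD invfM exprM.
rewrite mulrA ler_wpM2r ?invr_ge0 ?exprn_ge0 ?(ltW a0)//.
rewrite ler_wpM2r ?invr_ge0 ?exprn_ge0 ?(ltW a0)//.
rewrite ler_pM2l//; have := sum_ge c n c0; lra.
Qed.

Lemma test_fun_integral_ge (mu : {measure set (plane R) -> \bar R}) k a :
  Cplus a ->
  ((10 * complex.Re a ^+ 2) ^- k)%:E * mu (@cplx R @^-1` Carleson_square a) <=
  \int[mu]_(p in @cplx R @^-1` @Cplus R) (cabs (test_fun k a (cplx p)) ^+ 2)%:E.
Proof.
move=> a0; have mC := @measurable_Cplus R.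
set Q := _ @^-1` Carleson_square a.
have mQ : measurable Q.
  by rewrite /Q cplx_Carleson_square; apply: measurableX; exact: measurable_itv.
have QC : Q `<=` @cplx R @^-1` @Cplus R by move=> p [] /= /andP[].
have l0 : (0 <= (10 * complex.Re a ^+ 2) ^- k)%R.
  by rewrite invr_ge0 exprn_ge0// mulr_ge0// sqr_ge0.
have mI A : measurable_fun A (fun p : plane R => (\1_Q p)%:E : \bar R).
  by apply/measurable_EFinP; apply: measurable_indic.
rewrite -[X in mu X](setIidl QC) -integral_indic// -ge0_integralZl_EFin//.
apply: ge0_le_integral => //.
- by move=> p _; rewrite -EFinM lee_fin mulr_ge0.
- exact: measurable_funeM.
- apply/measurable_EFinP.
  under eq_fun do rewrite -[test_fun _ _ _]mul1r.
  exact: measurable_cabs_sqr_invX.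
- move=> p _; rewrite -EFinM lee_fin indicE.
  have [/set_mem Qp|_] := boolP (p \in Q); last by rewrite mulr0 sqr_ge0.
  by rewrite mulr1 test_fun_ge.
Qed.
End TestFunctions.

(** * Carleson measures *)

Theorem theorem2 (R : realType) (m : nat)
    (nu : 'I_m.+1 -> {measure set (measurableTypeR R) -> \bar R})
    (hnu : forall n : 'I_m.+1, Delta2_measure (nu n))
    (mu : {measure set (plane R) -> \bar R})
    (hmu : Carleson_measure nu mu) :
  exists2 C : R, 0 < C &
    forall a : R[i], Cplus a ->
      (mu (@cplx R @^-1` Carleson_square a) <=
       C%:E * \sum_(n < m.+1)
         strip_measure (nu n) (@cplx R @^-1` C_closure (Carleson_square a))
           / (complex.Re a ^+ (2 * n))%:E)%E.
Proof.
have [k [B B0 hB]] : exists k : nat, exists2 B : R, (0 < B)%R & _ :=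
  A2_normsq_test_fun m nu (fun n => let: And5 _ _ _ _ h := hnu n in h).
case: hmu => M M0 hM.
exists (M * 10 ^+ k * B); first by rewrite !mulr_gt0 ?exprn_gt0.
move=> a a0; move: (hB a a0).
set S := (\sum_(n < m.+1) _)%E => FS.
have [->|Soo] := eqVneq S +oo%E.
  by rewrite gt0_muley ?leey// lte_fin !mulr_gt0 ?exprn_gt0.
have x0 : 0 < complex.Re a ^+ 2 by rewrite exprn_gt0.
have Fk : A2 nu (test_fun k a).
  split; first exact: analytic_test_fun.
  apply: (le_lt_trans FS); apply: lte_mul_pinfty; rewrite ?ltey//.
  by rewrite lee_fin divr_ge0 ?(ltW B0)// ltW// exprn_gt0.
(* l is the inverse of the lower bound of the test function on the square. *)
pose l := (10 * complex.Re a ^+ 2) ^+ k.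
have l0 : 0 < l by rewrite exprn_gt0 ?mulr_gt0.
have M0' : (0 <= M%:E)%E by rewrite lee_fin ltW.
have l0' : (0 <= l%:E)%E by rewrite lee_fin ltW.
have muQ := le_trans (test_fun_integral_ge mu k a a0) (hM _ Fk).
have := lee_wpmul2l l0' (le_trans muQ (lee_wpmul2l M0' FS)).
rewrite !muleA -!EFinM divff ?gt_eqF// mul1e => /le_trans; apply.
rewrite le_eqVlt; apply/orP; left; apply/eqP; congr (_%:E * _)%E.
rewrite /l exprMn; field.
by rewrite expf_neq0// gt_eqF.
Qed.
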